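(* Let $T$ be a sublinear operator acting on measurable functions on $\mathbb{R}^n$ which satisfies a Fefferman-Stein inequality: there is a constant $c>0$ such that, for every positive locally integrable function $u$ on $\mathbb{R}^n$, every $y>0$ and every $f$, $$y\int_{\{|Tf(x)|>y\}}u(x)\,dx\le c\int_{\mathbb{R}^n}|f(x)|\,Mu(x)\,dx.$$ Then there is a constant $C>0$ such that, for every $t>0$ and every measurable function $f$, $$(Tf)^*(t)\le C\left(\frac1t\int_0^t f^*(s)\,ds+\int_t^\infty f^*(s)\,\frac{ds}{s}\right).$$
   Context: $M$ is the Hardy-Littlewood maximal operator on $\mathbb{R}^n$, $Mf(x)=\sup_{Q\ni x}\frac1{|Q|}\int_Q|f(y)|\,dy$, the supremum being over all cubes $Q$ containing $x$. The decreasing rearrangement with respect to Lebesgue measure is $f^*(t)=\inf\{s>0:|\{|f|>s\}|\le t\}$. *)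

(* Defs.v *)
From HB Require Import structures.
From mathcomp Require Import all_boot all_order all_algebra.
From mathcomp Require Import all_classical all_reals all_analysis measurable_realfun.
Import Order.TTheory GRing.Theory Num.Theory.
Import numFieldNormedType.Exports.

Set Implicit Arguments.
Unset Strict Implicit.
Unset Printing Implicit Defensive.

Local Open Scope classical_set_scope.
Local Open Scope ring_scope.
Local Open Scope ereal_scope.

(* The library has Lebesgue measure on R only.  On R^m with m = n.+1 >= 1,
   represented by 'rV[R]_n.+1, it is obtained here from Lebesgue's outer measure
   (covers by countably many boxes) through the library's Caratheodory
   construction.  "Measurable" below therefore means Lebesgue measurable. *)
Section lebesgue_rV.
Context {R : realType} {n : nat}.
Implicit Types A : set 'rV[R]_n.+1.

Definition box (a b : 'rV[R]_n.+1) : set 'rV[R]_n.+1 :=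
  [set x | forall i, (a ord0 i < x ord0 i <= b ord0 i)%R].

(* volume of [box a b], provided that a <= b coordinatewise *)
Definition box_volume (a b : 'rV[R]_n.+1) : R := (\prod_i (b ord0 i - a ord0 i))%R.

Definition box_cover A (a b : nat -> 'rV[R]_n.+1) :=
  (forall k i, (a k ord0 i <= b k ord0 i)%R) /\
  A `<=` \bigcup_k box (a k) (b k).

Definition lebesgue_outer A : \bar R :=
  ereal_inf [set v | exists a b : nat -> 'rV[R]_n.+1,
    box_cover A a b /\ v = \sum_(0 <= k <oo) (box_volume (a k) (b k))%:E].

Let box_volume_ge0 A a b k : box_cover A a b ->
  0 <= (box_volume (a k) (b k))%:E.
Proof.
by move=> [ab _]; rewrite lee_fin; apply: prodr_ge0 => i _; rewrite subr_ge0.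
Qed.

Lemma lebesgue_outer_ge0 A : 0 <= lebesgue_outer A.
Proof.
apply: le_ereal_inf_tmp => _ [a [b [abA ->]]].
by apply: nneseries_ge0 => k _ _; exact: (box_volume_ge0 _ abA).
Qed.

Lemma lebesgue_outer0 : lebesgue_outer set0 = 0.
Proof.
apply/eqP; rewrite eq_le lebesgue_outer_ge0 andbT.
apply: ereal_inf_lbound; exists (fun=> 0%R), (fun=> 0%R); split; first by split.
rewrite eseries0 // => k _ _.
by rewrite /box_volume big_ord_recl subrr mul0r.
Qed.

Lemma le_lebesgue_outer : {homo lebesgue_outer : A B / A `<=` B >-> A <= B}.
Proof.
move=> A B AB; apply: ereal_inf_le_tmp => _ [a [b [[ab Bab] ->]]].
by exists a, b; split => //; split => //; exact: subset_trans Bab.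
Qed.

Lemma lebesgue_outer_sigma_subadditive : sigma_subadditive lebesgue_outer.
Proof.
move=> A; have [[i ioo]|] := pselect (exists i, lebesgue_outer (A i) = +oo).
  rewrite (eseries_pinfty _ _ ioo) ?leey// => k _.
  by rewrite -ltNye (lt_le_trans _ (lebesgue_outer_ge0 _)).
rewrite -forallNE => Aoo.
suff add2e (e : {posnum R}) :
    lebesgue_outer (\bigcup_k A k) <=
      \sum_(i <oo) lebesgue_outer (A i) + e%:num%:E.
  by apply/lee_addgt0Pr => _/posnumP[].
rewrite (le_trans _ (epsilon_trick _ _ _))//; last first.
  by move=> k; exact: lebesgue_outer_ge0.
pose P k (B : nat -> 'rV[R]_n.+1 * 'rV[R]_n.+1) :=
  box_cover (A k) (fst \o B) (snd \o B) /\
  \sum_(0 <= j <oo) (box_volume (B j).1 (B j).2)%:E <=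
    lebesgue_outer (A k) + (e%:num / (2 ^ k.+1)%:R)%:E.
have [G PG] : {G : nat -> nat -> 'rV[R]_n.+1 * 'rV[R]_n.+1 & forall k, P k (G k)}.
  apply: (@choice _ _ P) => k; rewrite /P.
  have Afin : lebesgue_outer (A k) \is a fin_num.
    by rewrite ge0_fin_numE ?lebesgue_outer_ge0// ltey; apply/eqP/Aoo.
  have en1 : (0 < e%:num / (2 ^ k.+1)%:R)%R by [].
  have [_ [a [b [abA ->]]] vS] := lb_ereal_inf_adherent en1 Afin.
  by exists (fun j => (a j, b j)); split => //; exact/ltW.
pose vol (p : nat * nat) : \bar R := (box_volume (G p.1 p.2).1 (G p.1 p.2).2)%:E.
have vol_ge0 p : 0 <= vol p by exact: (box_volume_ge0 p.2 (PG p.1).1).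
apply: (@le_trans _ _ (\esum_(p in setT) vol p)).
  apply: ereal_inf_lbound => /=.
  have /card_esym/ppcard_eqP[f] := card_nat2.
  exists (fun k => (G (f k).1 (f k).2).1), (fun k => (G (f k).1 (f k).2).2).
  split; first split.
  - by move=> k; exact: (PG (f k).1).1.1.
  - move=> t [i _ /(PG i).1.2[j _ Bijt]].
    by exists (f^-1%FUN (i, j)) => //=; rewrite invK ?inE.
  - have f_inj : set_inj xpredT f by move=> i j _ _; apply: inj; rewrite inE.
    rewrite -[RHS](esum_pred_image vol f xpredT)//.
    congr esum; apply/esym/seteqP; split => // p _.
    by exists (f^-1%FUN p) => //; rewrite invK ?inE.
rewrite (_ : esum _ _ = \sum_(i <oo) \sum_(j <oo) vol (i, j)); last first.
  pose J : nat -> set (nat * nat) := fun i => [set (i, j) | j in setT].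
  rewrite (_ : setT = \bigcup_k J k); last first.
    by rewrite predeqE => -[a b]; split => // _; exists a => //; exists b.
  rewrite esum_bigcupT /=; last 2 first.
    - apply/trivIsetP => i j _ _ ij.
      rewrite predeqE => -[k m] /=; split => //= -[] [_] _ [<-{k} _].
      by move=> [m' _] [] /esym/eqP; rewrite (negbTE ij).
    - by move=> p; exact: vol_ge0.
  rewrite -(image_id [set: nat]) -fun_true esum_pred_image//; last first.
    by move=> k _; exact: esum_ge0.
  apply: eq_eseriesr => /= j _.
  rewrite -(esum_pred_image vol (pair j) predT)//=; last first.
    by move=> ? ? _ _; exact: (@can_inj _ _ _ snd).
  by congr esum; rewrite predeqE => -[a b]; split; move=> [i _ <-]; exists i.
apply: lee_lim.
- apply: is_cvg_nneseries => k *.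
  by apply: nneseries_ge0 => m *; exact: (vol_ge0 (k, m)).
- by apply: is_cvg_nneseries => k *; apply: adde_ge0 => //; exact: lebesgue_outer_ge0.
- by near=> k; apply: lee_sum => i _; exact: (PG i).2.
Unshelve. all: by end_near. Qed.

HB.instance Definition _ := isOuterMeasure.Build R 'rV[R]_n.+1 lebesgue_outer
  lebesgue_outer0 lebesgue_outer_ge0 le_lebesgue_outer
  lebesgue_outer_sigma_subadditive.

End lebesgue_rV.

(* R^(n+1) with the sigma-algebra of Lebesgue measurable sets *)
Definition Rn (R : realType) (n : nat) : measurableType _ :=
  caratheodory_type (@lebesgue_outer R n).

Definition lebesgue (R : realType) (n : nat) : set (Rn R n) -> \bar R :=
  @lebesgue_outer R n.

HB.instance Definition _ (R : realType) (n : nat) :=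
  isMeasure.Build _ _ _ (@lebesgue R n)
    (@caratheodory_measure0 _ _ (@lebesgue_outer R n))
    (@caratheodory_measure_ge0 _ _ (@lebesgue_outer R n))
    (@caratheodory_measure_sigma_additive _ _ (@lebesgue_outer R n)).

Section notions.
Context {R : realType} {n : nat}.
Local Notation mu := (@lebesgue R n).

(* open cube (sides parallel to the axes) of centre z and side length 2r *)
Definition cube (z : 'rV[R]_n.+1) (r : R) : set (Rn R n) :=
  [set y : 'rV[R]_n.+1 | forall i, (`|y ord0 i - z ord0 i| < r)%R].

Definition maximal (f : Rn R n -> R) (x : Rn R n) : \bar R :=
  ereal_sup [set a | exists (z : 'rV[R]_n.+1) (r : R),
    [/\ (0 < r)%R, cube z r x &
        a = (mu (cube z r))^-1 * \int[mu]_(y in cube z r) `|f y|%:E]].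

Definition locally_integrable_rV (u : Rn R n -> R) :=
  measurable_fun setT u /\
  forall K : set 'rV[R]_n.+1, compact K -> \int[mu]_(x in K) `|u x|%:E < +oo.

Definition rearrangement (f : Rn R n -> \bar R) (t : R) : \bar R :=
  ereal_inf [set s%:E | s in
    [set s : R | (0 < s)%R /\ mu [set x | s%:E < `|f x|] <= t%:E]].

(* Values in \bar R, so that the maximal operator itself is such a T. *)
Definition operator := {mfun Rn R n >-> R} -> {mfun Rn R n >-> \bar R}.

Definition sublinear (T : operator) :=
  (forall f g, {ae mu, forall x, `|T (f + g)%R x| <= `|T f x| + `|T g x|}) /\
  (forall (a : R) f,
    {ae mu, forall x, `|T (scale_mfun a f) x| = `|a|%:E * `|T f x|}).

Definition fefferman_stein (T : operator) (c : R) :=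
  forall (u : Rn R n -> R) (y : R) (f : {mfun Rn R n >-> R}),
    (forall x, 0 < u x)%R -> locally_integrable_rV u -> (0 < y)%R ->
    y%:E * \int[mu]_(x in [set x | y%:E < `|T f x|]) (u x)%:E <=
    c%:E * \int[mu]_x (`|f x|%:E * maximal u x).

End notions.

Arguments operator : clear implicits.

(* Main.v *)
Require Import Defs.
From HB Require Import structures.
From mathcomp Require Import all_boot all_order all_algebra.
From mathcomp Require Import all_classical all_reals all_analysis measurable_realfun.
From mathcomp Require Import ring lra.
Import Order.TTheory GRing.Theory Num.Theory.
Import numFieldNormedType.Exports.

Local Open Scope classical_set_scope.
Local Open Scope ring_scope.
Local Open Scope ereal_scope.

(* Let E be a part of finite measure m > t of {|Tf| > y}, and apply the
   Fefferman-Stein inequality to a weight u with 1_E <= u <= 1 and integral at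
   most 2m: y m <= c \int |f| Mu.  By the weak type (1,1) inequality the set
   {Mu > 2^-k} lies in a set V_k of measure at most a 2^k, where
   a = 2 * 5^(dimension) * m, and Mu <= \sum_k 2 2^-k 1_(V_k) since Mu <= 1.
   As \int_V |f| <= \int_0^(|V|) f^*, summing over k bounds y m by a constant
   times \int_0^oo f^*(s) min(1, m/s) ds, which is at most m times the
   right-hand side at t.  The exact volume of a cube is never needed, only how it
   scales. *)

(** * Lebesgue measure of cubes *)

Section lebesgue_Rn.
Context {R : realType} {n : nat}.
Local Notation rV := 'rV[R]_n.+1.
Local Notation mu := (@lebesgue R n).
Implicit Types (a b x y z : rV) (A : set rV) (r : R).

Definition replace_coord x (i : 'I_n.+1) (c : R) : rV :=
  (\row_j if j == i then c else x ord0 j)%R.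

(** The product is affine in its [i]-th factor, so cutting at height [m] is an algebraic identity,
    whatever the position of [m]. *)
Lemma box_volume_split a b i (m : R) :
  box_volume a b =
  (box_volume a (replace_coord b i m) + box_volume (replace_coord a i m) b)%R.
Proof.
have E c d : box_volume c d = ((d ord0 i - c ord0 i) *
    \prod_(j | j != i) (d ord0 j - c ord0 j))%R by rewrite /box_volume (bigD1 i).
rewrite !E !mxE eqxx.
under [X in (_ = _ * X + _)%R]eq_bigr => j /negPf ji do rewrite mxE ji.
under [X in (_ = _ + _ * X)%R]eq_bigr => j /negPf ji do rewrite mxE ji.
ring.
Qed.

Lemma box_cover_volume_ge0 A (a b : nat -> rV) k : box_cover A a b ->
  0 <= (box_volume (a k) (b k))%:E.
Proof.
by move=> [ab _]; rewrite lee_fin; apply: prodr_ge0 => i _; rewrite subr_ge0.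
Qed.

(** Caratheodory's criterion: cutting every box of a cover of [X] along the hyperplane yields covers
    of the two pieces of [X] with the same total volume. *)
Lemma measurable_halfspace (i : 'I_n.+1) (c : R) :
  measurable ([set x : rV | (x ord0 i <= c)%R] : set (Rn R n)).
Proof.
apply: le_caratheodory_measurable => X.
apply: le_ereal_inf_tmp => _ [a [b [abX ->]]].
have [ab Xab] := abX.
(* Clamping [c] to the [i]-th side of the box keeps both halves well ordered, even when the
   hyperplane misses the box. *)
pose m k := Num.max (a k ord0 i) (Num.min c (b k ord0 i)).
have am k : (a k ord0 i <= m k)%R by rewrite le_max lexx.
have mb k : (m k <= b k ord0 i)%R by rewrite ge_max ab ge_min lexx orbT.
pose b' k := replace_coord (b k) i (m k).
pose a' k := replace_coord (a k) i (m k).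
have c1 : box_cover (X `&` [set x | (x ord0 i <= c)%R]) a b'.
  split=> [k j|x [/Xab[k _ xk] /= xc]].
    by rewrite mxE; case: eqP => [->|_]; rewrite ?am ?ab.
  exists k => // j; rewrite mxE; case: eqP => [->|_]; last exact: xk.
  by have /andP[-> xb] := xk i; rewrite le_max le_min xc xb orbT.
have c2 : box_cover (X `&` ~` [set x | (x ord0 i <= c)%R]) a' b.
  split=> [k j|x [/Xab[k _ xk] /= /negP]].
    by rewrite mxE; case: eqP => [->|_]; rewrite ?mb ?ab.
  rewrite -ltNge => xc.
  exists k => // j; rewrite mxE; case: eqP => [->|_]; last exact: xk.
  by have /andP[ax ->] := xk i; rewrite andbT gt_max ax gt_min xc.
under eq_eseriesr => k _ do rewrite (box_volume_split _ _ i (m k)) EFinD.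
rewrite nneseriesD; last 2 first.
- by move=> k _ _; exact: box_cover_volume_ge0 c1.
- by move=> k _ _; exact: box_cover_volume_ge0 c2.
by apply: leeD; apply: ereal_inf_lbound; [exists a, b'|exists a', b].
Qed.

Lemma measurable_coord (i : 'I_n.+1) :
  measurable_fun setT (fun x : Rn R n => (x : rV) ord0 i).
Proof.
apply: (measurability _ (RGenOInfty.measurableE R)) => _ [_ [c ->] <-].
rewrite setTI (_ : _ @^-1` _ = ~` [set x : rV | (x ord0 i <= c)%R]).
  exact/measurableC/measurable_halfspace.
by apply/seteqP; split => x /=; rewrite in_itv/= andbT real_ltNge ?num_real// => /negP.
Qed.

Lemma measurable_cube z r : measurable (cube z r).
Proof.
rewrite (_ : cube z r =
  \bigcap_(i in [set: 'I_n.+1]) ((fun x : Rn R n => (x : rV) ord0 i) @^-1`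
     `](z ord0 i - r)%R, (z ord0 i + r)%R[%classic)).
  apply: fin_bigcap_measurable => // i _.
  by rewrite -[X in measurable X]setTI; exact: measurable_coord.
apply/seteqP; split => [x xz i _|x xz i]/=; last have := xz i I.
  by rewrite in_itv/= -ltr_distl.
by rewrite /= in_itv/= -ltr_distl.
Qed.

Lemma lebesgue_cube_lty z r : mu (cube z r) < +oo.
Proof.
have [r0|r0] := leP r 0%R.
  rewrite (_ : cube z r = set0) ?measure0 ?ltry//.
  by apply/seteqP; split => // x /(_ ord0) /(le_lt_trans (normr_ge0 _)); rewrite ltNge r0.
(* A single box covers the cube; the cover is continued by boxes degenerate at [z], of volume 0. *)
pose a k : rV := if k is 0%N then (z - const_mx r)%R else z.
pose b k : rV := if k is 0%N then (z + const_mx r)%R else z.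
have zr : box_cover (cube z r) a b.
  split => [[|k] i/=|x xz]; rewrite ?mxE ?lexx//; first lra.
  exists 0%N => // i; rewrite !mxE; have := xz i; rewrite ltr_distl.
  by move=> /andP[-> /ltW].
apply: (@le_lt_trans _ _ (\sum_(0 <= k <oo) (box_volume (a k) (b k))%:E)).
  by apply: ereal_inf_lbound; exists a, b.
rewrite (nneseries_split 0 1); last by move=> k _; exact: box_cover_volume_ge0 zr.
rewrite eseries0 ?adde0 ?big_nat1 ?ltry//.
by move=> [|k]// _ _; rewrite /box_volume big_ord_recl subrr mul0r.
Qed.

(** The map carries a box cover of [A] to a box cover of the image, each volume being multiplied by
    [k ^+ n.+1]. *)
Lemma lebesgue_outer_affine A z k : (0 < k)%R ->
  lebesgue_outer [set (z + k *: x)%R | x in A] <= (k ^+ n.+1)%:E * lebesgue_outer A.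
Proof.
move=> k0; have kn0 : (0 < k ^+ n.+1)%R by rewrite exprn_gt0.
rewrite -lee_pdivrMl//; apply: le_ereal_inf_tmp => _ [a [b [abA ->]]].
rewrite lee_pdivrMl// -nneseriesZl; last first.
  by move=> j _; exact: box_cover_volume_ge0 abA.
have [ab Aab] := abA.
apply: ereal_inf_lbound.
exists (fun j => z + k *: a j)%R, (fun j => z + k *: b j)%R; split; first split.
- by move=> j i; rewrite !mxE lerD2l ler_pM2l.
- move=> _ [x /Aab[j _ xj] <-]; exists j => // i; rewrite !mxE.
  by rewrite ltrD2l lerD2l ltr_pM2l// ler_pM2l.
- apply: eq_eseriesr => j _; congr EFin.
  rewrite /box_volume; transitivity (\prod_(i < n.+1) (k * (b j ord0 i - a j ord0 i)))%R.
    by rewrite big_split/= prodr_const card_ord.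
  by apply: eq_bigr => i _; rewrite !mxE; ring.
Qed.

(** The homothety of ratio [k] sending [z] to [y] has translation part [y - k *: z]. With arbitrary
    centres, this covers both dilation and translation. *)
Lemma lebesgue_cube_scale y z r k : (0 < k)%R ->
  mu (cube y (k * r)) <= (k ^+ n.+1)%:E * mu (cube z r).
Proof.
move=> k0; apply: le_trans (lebesgue_outer_affine (cube z r) (y - k *: z) _ k0).
apply: le_lebesgue_outer => x xy; exists (z + k^-1 *: (x - y))%R.
  move=> i; have := xy i; rewrite !mxE addrAC subrr add0r normrM.
  by rewrite gtr0_norm ?invr_gt0// ltr_pdivrMl.
by apply/rowP => i; rewrite !mxE; field; rewrite gt_eqF.
Qed.

End lebesgue_Rn.

(** * Weak type inequality for the maximal operator *)

(* Zorn on the disjoint subfamilies [G] such that every set of [F] that meets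
   a member of [G] meets one whose radius is at least half its own. *)
Lemma vitali_selection (R : realType) (I X : Type) (B : I -> set X)
    (rad : I -> R) (F : set I) (M : R) :
  (forall i, F i -> 0 < rad i <= M)%R -> (forall i, F i -> B i !=set0) ->
  exists G, [/\ G `<=` F, trivIset G B &
    forall i, F i -> exists j, [/\ G j, B i `&` B j !=set0 & (rad i <= 2 * rad j)%R]].
Proof.
move=> Frad F0.
pose meets G i := exists2 j, G j & B i `&` B j !=set0.
pose good (G : set I) := [/\ G `<=` F, trivIset G B &
  forall i, F i -> meets G i ->
    exists j, [/\ G j, B i `&` B j !=set0 & (rad i <= 2 * rad j)%R]].
have [Gs Gsgood chain|G [[GF Gtriv Ggood] Gmax]] := @Zorn_bigcup _ good.
  split=> [i [Y GsY]|i j [Y GsY Yi] [Z GsZ Zj]|i Fi [j [Y GsY Yj] ij]].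
  - by have [+ _ _] := Gsgood _ GsY; exact.
  - by have [YZ|ZY] := chain _ _ GsY GsZ; [have [_ + _] := Gsgood _ GsZ|
       have [_ + _] := Gsgood _ GsY]; apply => //; [exact: YZ|exact: ZY].
  - have [_ _ /(_ i Fi)[|k [Yk ik rik]]] := Gsgood _ GsY; first by exists j.
    by exists k; split => //; exists Y.
(* By [Ggood] only an [i0] meeting no member of [G] can fail. The set [N] of such indices is then
   nonempty, and an almost largest one could be added to [G]. *)
exists G; split => // i0 Fi0; apply: (Ggood _ Fi0); apply: contrapT => Ni0.
pose N := [set i | F i /\ ~ meets G i].
have supN : has_sup (rad @` N).
  split; first by exists (rad i0), i0.
  by exists M => _ [i [Fi _] <-]; have /andP[] := Frad i Fi.
have ub i : N i -> (rad i <= sup (rad @` N))%R.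
  by move=> Ni; apply: sup_upper_bound => //; exists i.
have sup0 : (0 < sup (rad @` N))%R.
  by apply: lt_le_trans (ub i0 _) => //; have /andP[] := Frad i0 Fi0.
have sup20 : (0 < sup (rad @` N) / 2)%R by rewrite divr_gt0.
(* The radius of [i1] exceeds half the supremum over [N], so it serves every index of [N] that meets
   it; indices meeting [G] are already served. *)
have [_ [i1 [Fi1 Gi1] <-] i1sup] := sup_adherent sup20 supN.
apply: (Gmax (G `|` [set i1])).
  split; first by move=> i Gi; left.
  move=> /(_ i1 (or_intror erefl)) Gi1'; apply: Gi1; exists i1 => //.
  by rewrite setIid; exact: F0.
split=> [i [/GF//|->//]|i j [Gi|->] [Gj|->]//|i Fi iG].
- exact: Gtriv.
- by move=> ij; case: Gi1; exists i => //; rewrite setIC.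
- by move=> ij; case: Gi1; exists j.
have [iG'|iG'] := pselect (meets G i).
  by have [j [Gj ij rij]] := Ggood i Fi iG'; exists j; split => //; left.
case: iG => j [Gj|->] ij; first by case: iG'; exists j.
exists i1; split => //; first by right.
have /(_ _)/le_trans := ub i; apply; first by split.
lra.
Qed.

Section weak_type.
Context {R : realType} {n : nat}.
Local Notation rV := 'rV[R]_n.+1.
Local Notation mu := (@lebesgue R n).

Lemma cube_rat (z : rV) (r : R) : (0 < r)%R ->
  exists q : 'rV[rat]_n.+1, cube z r (map_mx ratr q).
Proof.
move=> r0.
have /fin_all_exists[q qP] (i : 'I_n.+1) :
    exists q : rat, (`|ratr q - z ord0 i| < r)%R.
  have /rat_in_itvoo[q] : (z ord0 i - r < z ord0 i + r)%R by lra.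
  by rewrite in_itv/= -ltr_distl => ?; exists q.
by exists (\row_i q i)%R => i; rewrite !mxE.
Qed.

Lemma cube_eq0 (z : rV) (r : R) : (r <= 0)%R -> cube z r = set0.
Proof.
move=> r0; apply/seteqP; split => // x /(_ ord0) /(le_lt_trans (normr_ge0 _)).
by rewrite ltNge r0.
Qed.

(** Disjoint nonempty open cubes contain distinct rational points, whose codes enumerate the
    selected family. *)
Lemma vitali_cubes (F : set (rV * R)) (M : R) :
  (forall i, F i -> 0 < i.2 <= M)%R ->
  exists z : nat -> rV, exists r : nat -> R,
    [/\ forall k, (r k = 0)%R \/ F (z k, r k),
        trivIset setT (fun k => cube (z k) (r k)) &
        forall i, F i -> exists k, cube i.1 i.2 `<=` cube (z k) (5 * r k)].
Proof.
move=> FM.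
have [i Fi|G [GF Gtriv Gmeet]] :=
    @vitali_selection R _ _ (fun i => cube i.1 i.2) snd F M FM.
  have /andP[i0 _] := FM i Fi; have [q qP] := cube_rat i.1 _ i0.
  by exists (map_mx ratr q).
have /choice[q qP] (i : rV * R) :
    exists q : 'rV[rat]_n.+1, F i -> cube i.1 i.2 (map_mx ratr q).
  have [Fi|Fi] := pselect (F i); last by exists 0%R.
  by have /andP[i0 _] := FM i Fi; have [q qP] := cube_rat i.1 _ i0; exists q.
pose P k := [set i | G i /\ pickle (q i) = k].
pose s k : rV * R := xget (0, 0)%R (P k).
have sP k : (s k).2 = 0%R \/ P k (s k).
  by rewrite /s; case: xgetP => [i -> Pi|_]; [right|left].
exists (fst \o s), (snd \o s); split.
- move=> k; have [s0|[Gs _]] := sP k; first by left.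
  by right; rewrite /= -surjective_pairing; exact: GF.
- move=> k l _ _ /=; have [->|[Gk kE]] := sP k.
    by rewrite cube_eq0// set0I => /set0P/eqP.
  have [->|[Gl lE]] := sP l; first by rewrite [X in _ `&` X]cube_eq0// setI0 => /set0P/eqP.
  by move=> kl; rewrite -kE -lE (Gtriv _ _ Gk Gl kl).
- move=> i Fi; have [j [Gj [x [ix jx]] ij]] := Gmeet i Fi.
  exists (pickle (q j)) => /=; set k := pickle _.
  (* Two members of [G] with the same code share a rational point, so they coincide by
     disjointness. *)
  have -> : s k = j.
    rewrite /s; case: xgetP => [j' _ [Gj' qj']|/(_ j)[]//].
    apply: Gtriv => //; exists (map_mx ratr (q j)); split; last exact/qP/GF.
    by rewrite -(pcan_inj pickleK qj'); exact/qP/GF.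
  (* Going from [y] to the centre of [j] through the centre of [i] and the common point [x] costs
     less than twice the radius of [i] plus that of [j], at most five times the latter. *)
  move=> y iy l; have := ix l; have := jx l; have := iy l.
  rewrite !ltr_distl => /andP[? ?] /andP[? ?] /andP[? ?].
  by apply/andP; split; lra.
Qed.

(** Cubes have not been shown to have positive measure. On a null cube the integral vanishes, hence
    so does the average, which then cannot exceed [l]. *)
Lemma lt_cube_average (u : Rn R n -> R) (z : rV) (r l : R) :
  measurable_fun setT u -> (0 < l)%R ->
  l%:E < (mu (cube z r))^-1 * \int[mu]_(y in cube z r) `|u y|%:E ->
  l%:E * mu (cube z r) < \int[mu]_(y in cube z r) `|u y|%:E.
Proof.
move=> mu_ l0.
have mau : measurable_fun (cube z r) (fun y : Rn R n => `|u y|%:E).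
  apply/measurable_EFinP/measurableT_comp => //.
  exact: measurable_funS mu_.
have [m mE] : exists m : R, mu (cube z r) = m%:E.
  exists (fine (mu (cube z r))).
  by rewrite fineK// ge0_fin_numE// lebesgue_cube_lty.
have m0 : (0 <= m)%R by rewrite -lee_fin -mE.
have := @null_set_integral _ _ _ mu (cube z r) _ (measurable_cube z r) mau.
rewrite mE; move: m0; rewrite le_eqVlt => /predU1P[m0 null|m0 _].
  rewrite (null (etrans mE (congr1 EFin (esym m0)))).
  by rewrite mule0 lte_fin ltNge (ltW l0).
by rewrite inver gt_eqF// lte_pdivlMl// muleC.
Qed.

(** Vitali covering of the cubes on which the average of [|u|] exceeds [l]. The measurable superset
    [V] avoids discussing the measurability of [maximal u]. *)
Lemma maximal_weak_type (u : Rn R n -> R) (l I : R) :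
  measurable_fun setT u -> (0 < l)%R ->
  \int[mu]_x `|u x|%:E <= I%:E ->
  exists V : set (Rn R n), [/\ measurable V,
    [set x | l%:E < maximal u x] `<=` V & mu V <= (5 ^+ n.+1 * (I / l))%:E].
Proof.
move=> mu_ l0 uI.
have mau (D : set (Rn R n)) : measurable_fun D (fun y => `|u y|%:E).
  apply/measurable_EFinP/measurableT_comp => //; exact: measurable_funS mu_.
have uQ z r : \int[mu]_(y in cube z r) `|u y|%:E <= I%:E.
  apply: le_trans uI; apply: ge0_subset_integral => //; exact: measurable_cube.
pose F := [set i : rV * R | (0 < i.2)%R /\
  l%:E * mu (cube i.1 i.2) < \int[mu]_(y in cube i.1 i.2) `|u y|%:E].
pose m := fine (mu (cube (0 : rV)%R 1)).
have muE : mu (cube (0 : rV)%R 1) = m%:E.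
  by rewrite fineK// ge0_fin_numE ?lebesgue_cube_lty.
(* The selection needs bounded radii. For a radius [r > 1] the volume is at least
   [r ^+ n.+1 * m >= r * m], while [l] times the volume is below [I]. *)
have FM i : F i -> (0 < i.2 <= Num.max 1 (I / (l * m)))%R.
  move=> [i0 iF]; rewrite i0/= le_max.
  have [//|i1] := leP i.2 1%R; rewrite /=.
  have iq : mu (cube i.1 i.2) \is a fin_num.
    by rewrite ge0_fin_numE ?lebesgue_cube_lty.
  have mi : (i.2 * m <= fine (mu (cube i.1 i.2)))%R.
    rewrite -lee_fin fineK//; have vi0 : (0 < i.2^-1)%R by rewrite invr_gt0.
    have := lebesgue_cube_scale (0%R : rV) i.1 i.2 _ vi0; rewrite mulVf ?gt_eqF//.
    rewrite muE -(fineK iq) -!EFinM !lee_fin exprVn ler_pdivlMl ?exprn_gt0//.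
    apply: le_trans; rewrite ler_wpM2r//; first by rewrite fine_ge0.
    by rewrite ler_eXnr// ltW.
  have lI : (l * fine (mu (cube i.1 i.2)) < I)%R.
    by rewrite -lte_fin EFinM fineK//; apply: lt_le_trans iF _.
  (* If the unit cube were null, so would be every cube by scaling, and the strict inequality
     defining [F] would read [0 < 0]. *)
  have m0 : (0 < m)%R.
    rewrite lt_neqAle fine_ge0// andbT; apply/eqP => m0.
    have := lebesgue_cube_scale i.1 0%R 1%R _ i0.
    rewrite mulr1 muE -m0 mule0 => q0.
    have {}q0 : mu (cube i.1 i.2) = 0 by apply/eqP; rewrite eq_le q0/=.
    move: iF; rewrite null_set_integral//; first by rewrite q0 mule0 ltxx.
    exact: measurable_cube.
  rewrite ler_pdivlMr ?mulr_gt0//; apply: le_trans (ltW lI).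
  by rewrite mulrCA ler_pM2l.
have [z [r [zr triv cov]]] := vitali_cubes F _ FM.
exists (\bigcup_k cube (z k) (5 * r k)%R); split.
- by apply: bigcupT_measurable => k; exact: measurable_cube.
- move=> x /ereal_sup_gt[_ [y [s [s0 ys ->]]] /lt_cube_average] ave.
  by have [|k ks] := cov (y, s); [split => //; exact: ave|exists k => //; exact: ks].
apply: (@le_trans _ _ (\sum_(0 <= k <oo) mu (cube (z k) (5 * r k)%R))).
  apply: measure_sigma_subadditive => // [k|]; first exact: measurable_cube.
  by apply: bigcupT_measurable => k; exact: measurable_cube.
have mQ k : measurable (cube (z k) (r k)) by exact: measurable_cube.
have c0 : (0 <= 5 ^+ n.+1 / l :> R)%R by rewrite divr_ge0 ?exprn_ge0 ?ltW.
(* Each enlarged cube costs a factor [5 ^+ n.+1] in measure; the original cubes are disjoint, so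
   their integrals add up to at most [I]. *)
apply: (@le_trans _ _ (\sum_(0 <= k <oo)
    ((5 ^+ n.+1 / l)%:E * \int[mu]_(y in cube (z k) (r k)) `|u y|%:E))).
  apply: lee_nneseries => [k _ _|k _]; first exact: measure_ge0.
  apply: le_trans (lebesgue_cube_scale (z k) (z k) (r k) 5%R _) _ => //.
  rewrite EFinM -muleA; apply: lee_wpmul2l; first by rewrite lee_fin exprn_ge0.
  rewrite lee_pdivlMl//; case: (zr k) => [->|[_ /ltW//]].
  by rewrite cube_eq0// measure0 mule0 integral_ge0.
rewrite nneseriesZl; last by move=> k _; exact: integral_ge0.
rewrite -ge0_integral_bigcup//.
have -> : (5 ^+ n.+1 * (I / l) = 5 ^+ n.+1 / l * I)%R by ring.
rewrite [leRHS]EFinM; apply: lee_wpmul2l; first by rewrite lee_fin.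
apply: le_trans uI; apply: ge0_subset_integral => //.
exact: bigcupT_measurable.
Qed.

End weak_type.

(** * Rearrangements *)

Section layer_cake.
Context {R : realType}.

Lemma nneseries_le (u : nat -> \bar R) (M : \bar R) :
  (forall k, 0 <= u k) -> (forall N, \sum_(0 <= k < N) u k <= M) ->
  \sum_(0 <= k <oo) u k <= M.
Proof.
move=> u0 uM; apply: lime_le; first by apply: is_cvg_nneseries => k _ _.
by apply: nearW => N; exact: uM.
Qed.

(** The series counts the levels [d, 2d, ...] not exceeding [g]: it is [g] rounded down to a
    multiple of [d]. *)
Lemma stair_le (d : R) (g : \bar R) : (0 < d)%R -> 0 <= g ->
  \sum_(0 <= k <oo) (d * ((k.+1%:R * d)%:E <= g)%E%:R)%:E <= g.
Proof.
move=> d0 g0; apply: nneseries_le => [k|N].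
  by rewrite lee_fin mulr_ge0 // ltW.
elim: N => [|N IH]; first by rewrite big_nil.
have [Ng|Ng] := boolP ((N.+1%:R * d)%:E <= g); last first.
  by rewrite big_nat_recr//= (negbTE Ng) mulr0 adde0.
apply: le_trans Ng; rewrite sumEFin lee_fin mulr_natl -[in leRHS](subn0 N.+1).
rewrite -sumr_const_nat; apply: ler_sum => k _.
by rewrite ler_piMr ?(ltW d0)// lern1 leq_b1.
Qed.

Lemma le_stair (d g : R) : (0 < d)%R -> (0 <= g)%R ->
  g%:E <= d%:E + \sum_(0 <= k <oo) (d * ((k.+1%:R * d)%:E <= g%:E)%E%:R)%:E.
Proof.
move=> d0 g0; set N := Num.truncn (g / d).
have gd0 : (0 <= g / d)%R by rewrite divr_ge0// ltW.
have /andP[Ng gN] := truncn_itv gd0.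
apply: (@le_trans _ _ (d%:E + \sum_(0 <= k < N) (d * ((k.+1%:R * d)%:E <= g%:E)%E%:R)%:E)).
  rewrite (@eq_big_nat _ _ _ _ _ _ (fun=> d%:E)); last first.
    move=> k /andP[_ kN]; rewrite lee_fin -ler_pdivlMr// (le_trans _ Ng) ?mulr1//.
    by rewrite ler_nat.
  rewrite sumEFin -EFinD lee_fin sumr_const_nat subn0 -mulrS -mulr_natl.
  by rewrite -ler_pdivrMr// ltW.
rewrite leeD2l//; apply: nneseries_lim_ge => k _.
by rewrite lee_fin mulr_ge0 // ltW.
Qed.

Context d (T : measurableType d) (mu : {measure set T -> \bar R}).

(** The integral of a nonnegative function is a supremum over the simple functions below it, so no
    measurability enters. This allows integrands containing [maximal u]. *)
Lemma le_ge0_integral (f g : T -> \bar R) :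
  (forall x, 0 <= f x) -> (forall x, f x <= g x) ->
  \int[mu]_x f x <= \int[mu]_x g x.
Proof.
move=> f0 fg; have g0 x : 0 <= g x by exact: le_trans (fg x).
rewrite !ge0_integralTE//; apply: ereal_sup_le => _ [h hf <-].
by exists h => // x; exact: le_trans (hf x) (fg x).
Qed.

Section staircase.
Variables (D : set T) (g : T -> \bar R) (e : R).
Hypotheses (mD : measurable D) (mg : measurable_fun D g) (e0 : (0 < e)%R).

Let level (k : nat) := D `&` [set x | (k.+1%:R * e)%:E <= g x].

Let mlevel (k : nat) :
  measurable (level k).
Proof. by apply: emeasurable_fun_c_infty. Qed.

Let stepE k : {in D, (fun x => (e * ((k.+1%:R * e)%:E <= g x)%E%:R)%:E) =1
  (fun x => e%:E * (\1_(level k) x)%:E)}.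
Proof.
move=> x xD; rewrite EFinM indicE in_setI xD/=; congr (_ * (_ %:R)%:E).
by congr nat_of_bool; apply/idP/idP; rewrite inE.
Qed.

Let mindic k : measurable_fun D (fun x => (\1_(level k) x)%:E : \bar R).
Proof. by apply/measurable_EFinP/measurable_indic; exact: mlevel. Qed.

Let mstep k : measurable_fun D (fun x => (e * ((k.+1%:R * e)%:E <= g x)%E%:R)%:E).
Proof.
apply: (eq_measurable_fun (fun x => e%:E * (\1_(level k) x)%:E)).
  by move=> x xD; rewrite stepE.
by apply: measurable_funeM; exact: mindic.
Qed.

Lemma measurable_stair : measurable_fun D
  (fun x => \sum_(0 <= k <oo) (e * ((k.+1%:R * e)%:E <= g x)%E%:R)%:E).
Proof.
apply: (@ge0_emeasurable_sum _ _ _ D _ xpredT) => // k x _ _.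
by rewrite lee_fin mulr_ge0// ltW.
Qed.

(** Integrals of staircases over different measure spaces can thus be compared through the measures
    of their level sets. *)
Lemma integral_stair :
  \int[mu]_(x in D) \sum_(0 <= k <oo) (e * ((k.+1%:R * e)%:E <= g x)%E%:R)%:E =
  \sum_(0 <= k <oo) e%:E * mu (D `&` [set x | (k.+1%:R * e)%:E <= g x]).
Proof.
rewrite integral_nneseries//; last first.
  by move=> k x _; rewrite lee_fin mulr_ge0// ltW.
apply: eq_eseriesr => k _; rewrite (eq_integral _ _ (stepE k)).
rewrite ge0_integralZl//; last by rewrite lee_fin ltW.
by rewrite integral_indic// /level setIAC setIid.
Qed.

End staircase.
End layer_cake.

(** * Rearrangements and integrals over sets of given measure *)

Section rearrangement.
Context {R : realType} {n : nat}.
Local Notation mu := (@lebesgue R n).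
Local Notation lambda := (@lebesgue_measure R).

Lemma rearrangement_ge0 (f : Rn R n -> \bar R) t : 0 <= rearrangement f t.
Proof. by apply: le_ereal_inf_tmp => _ [s [s0 _] <-]; rewrite lee_fin ltW. Qed.

Lemma rearrangement_nonincreasing (f : Rn R n -> \bar R) :
  {homo rearrangement f : s t / (s <= t)%R >-> t <= s}.
Proof.
move=> s t st; apply: ereal_inf_le_tmp => _ [r [r0 rs] <-]; exists r => //.
by split => //; rewrite (le_trans rs) ?lee_fin.
Qed.

Lemma measurable_rearrangement (f : Rn R n -> \bar R) (D : set R) :
  measurable_fun D (rearrangement f).
Proof.
apply: (@measurable_funS _ _ _ _ setT) => //.
apply: (measurability _ (ErealGenOInfty.measurableE R)) => _ [_ [c ->] <-].
rewrite setTI; apply: is_interval_measurable => s t /=.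
rewrite !in_itv/= !andbT => cs ct r /andP[_ rt].
by rewrite in_itv/= andbT (lt_le_trans ct)// rearrangement_nonincreasing.
Qed.

Lemma lt_rearrangement (f : Rn R n -> \bar R) (t y : R) : (0 < y)%R ->
  y%:E < rearrangement f t -> t%:E < mu [set x | y%:E < `|f x|].
Proof.
move=> y0; apply: contraTT; rewrite -!leNgt => yt.
by apply: ereal_inf_lbound; exists y.
Qed.

Lemma le_rearrangement (f : Rn R n -> \bar R) (t y : R) :
  t%:E < mu [set x | y%:E <= `|f x|] -> y%:E <= rearrangement f t.
Proof.
move=> ty; apply: le_ereal_inf_tmp => _ [s [s0 st] <-].
rewrite lee_fin leNgt; apply/negP => sy; move: ty; apply/negP; rewrite -leNgt.
apply: le_trans st; apply: le_lebesgue_outer => x /=; apply: lt_le_trans.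
by rewrite lte_fin.
Qed.

(** Each level set of [|f|] inside [V] is no larger than the corresponding level set of the
    rearrangement inside []0, a[]; the staircases of step [d] are compared level by level. *)
Lemma integral_le_rearrangement (f : {mfun Rn R n >-> R}) (V : set (Rn R n)) (a : R) :
  measurable V -> mu V <= a%:E ->
  \int[mu]_(x in V) `|f x|%:E <=
  \int[lambda]_(s in `]0%R, a[) rearrangement (EFin \o f) s.
Proof.
move=> mV Va.
have a0 : (0 <= a)%R by rewrite -lee_fin (le_trans _ Va).
have a1 : (0 < a + 1)%R by lra.
(* Rounding down loses at most [d * a <= e] over [V]; the [+ 1] handles [a = 0]. *)
apply/lee_addgt0Pr => e e0; set d := (e / (a + 1))%R.
have d0 : (0 < d)%R by rewrite divr_gt0.
have mf : measurable_fun V (fun x : Rn R n => `|f x|%:E).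
  apply/measurable_EFinP/measurableT_comp => //.
  exact: (measurable_funS measurableT).
pose L k := V `&` [set x | (k.+1%:R * d)%:E <= `|f x|%:E].
pose S k := `]0%R, a[%classic `&`
  [set s | (k.+1%:R * d)%:E <= rearrangement (EFin \o f) s].
have mL k : measurable (L k) by exact: emeasurable_fun_c_infty.
have mS k : measurable (S k).
  by apply: emeasurable_fun_c_infty => //; exact: measurable_rearrangement.
have LS k : mu (L k) <= lambda (S k).
  have La : mu (L k) <= a%:E.
    by apply: le_trans Va; apply: le_lebesgue_outer => x [].
  have Lfin : mu (L k) \is a fin_num.
    by rewrite ge0_fin_numE//; apply: le_lt_trans La _; exact: ltry.
  have [->//|Ln0] := eqVneq (mu (L k)) 0.
  (* For [s] below the measure of [L k], the rearrangement at [s] is at least the level, so [S k]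
     contains this interval. *)
  have <- : lambda `]0%R, fine (mu (L k))[%classic = mu (L k).
    rewrite lebesgue_measure_itv/= lte_fin fine_gt0 ?sube0 ?fineK//.
    by rewrite lt0e Ln0 measure_ge0 -ge0_fin_numE.
  apply: le_measure; rewrite ?inE; [exact: measurable_itv|exact: mS|].
  move=> s /=; rewrite in_itv/= => /andP[s0 sL].
  split; first by rewrite /= in_itv/= s0 (lt_le_trans sL)// -lee_fin fineK.
  apply: le_rearrangement.
  apply: (@lt_le_trans _ _ (mu (L k))); first by rewrite -(fineK Lfin) lte_fin.
  by apply: le_lebesgue_outer => x [].
apply: (@le_trans _ _ (\int[mu]_(x in V) (d%:E +
    \sum_(0 <= k <oo) (d * ((k.+1%:R * d)%:E <= `|f x|%:E)%E%:R)%:E))).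
  rewrite integral_mkcond [leRHS]integral_mkcond; apply: le_ge0_integral => x.
    by rewrite /patch; case: ifP.
  by rewrite /patch; case: ifP => // _; exact: le_stair.
rewrite (ge0_integralD _ mV); first last.
- exact: measurable_stair.
- by move=> x _; apply: nneseries_ge0 => k _ _; rewrite lee_fin mulr_ge0// ltW.
- exact: measurable_cst.
- by move=> x _; rewrite lee_fin ltW.
rewrite integral_stair// integral_cst// addeC; apply: leeD.
  apply: (@le_trans _ _ (\sum_(0 <= k <oo) d%:E * lambda (S k))).
    apply: lee_nneseries => [k _ _|k _].
      by rewrite mule_ge0// lee_fin ltW.
    by apply: lee_wpmul2l; rewrite ?lee_fin ?(ltW d0)//; exact: LS.
  rewrite -integral_stair//; last exact: measurable_rearrangement.
  rewrite integral_mkcond [leRHS]integral_mkcond; apply: le_ge0_integral => x.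
    rewrite /patch; case: ifP => // _.
    by apply: nneseries_ge0 => k _ _; rewrite lee_fin mulr_ge0// ltW.
  rewrite /patch; case: ifP => // _; apply: stair_le => //.
  exact: rearrangement_ge0.
apply: (@le_trans _ _ (d%:E * a%:E)).
  by apply: lee_wpmul2l; rewrite ?lee_fin ?(ltW d0).
rewrite -EFinM lee_fin /d mulrAC ler_pdivrMr// ler_wpM2l ?(ltW e0)//; lra.
Qed.

End rearrangement.

(** * Dyadic summation *)

Section dyadic.
Context {R : realType}.

(** Splitting off [k = 0] and halving the rest replaces [b] by [2 * b], whence the induction on [N]
    for all [b]. *)
Lemma sum_dyadic_lt (b : R) N : (0 <= b)%R ->
  (\sum_(0 <= k < N) 2 ^- k * (2 ^- k < b)%R%:R <= 2 * Num.min 1 b)%R.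
Proof.
elim: N b => [|N IH] b b0.
  by rewrite big_nil mulr_ge0// le_min ler01.
rewrite big_nat_recl// expr0 invr1 mul1r.
rewrite (eq_bigr (fun k => 2^-1 * (2 ^- k * (2 ^- k < 2 * b)%R%:R))%R); last first.
  move=> k _; rewrite exprS invfM mulrA; congr (_ * _ %:R)%R.
  by rewrite ltr_pdivrMl.
rewrite -mulr_sumr.
have /IH {}IH : (0 <= 2 * b)%R by rewrite mulr_ge0.
move: IH; set S := (\sum_(_ <= _ < _) _)%R.
case: ltP => b1 /=; rewrite ?mulr1n ?mulr0n; case: (ltP 1%R (2 * b)%R) => ? ?; lra.
Qed.

Lemma dyadic_lt (m : R) : (0 < m)%R -> exists k, (2 ^- k < m)%R.
Proof.
move=> m0; exists (Num.truncn m^-1).+1.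
rewrite invf_plt ?posrE ?exprn_gt0//.
have mV0 : (0 <= m^-1)%R by rewrite invr_ge0 ltW.
have /andP[_ mk] := truncn_itv mV0; apply: lt_le_trans mk _.
by rewrite -natrX ler_nat ltnW// ltn_expl.
Qed.

(** One term suffices: if [k] is least with [2 ^- k < m], then [k >= 1] since [m <= 1], and
    [m <= 2 * 2 ^- k] by minimality. *)
Lemma le_dyadic_series (m : \bar R) (P : nat -> bool) : 0 <= m <= 1 ->
  (forall k, (2 ^- k)%:E < m -> P k) ->
  m <= \sum_(0 <= k <oo) (2 * 2 ^- k * (P k)%:R)%:E.
Proof.
case: m => [m| |]; [|by move=> /andP[]|by move=> /andP[]].
rewrite !lee_fin => /andP[+ m1] mP.
have s0 k : 0 <= (2 * 2 ^- k * (P k)%:R)%:E :> \bar R.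
  by rewrite lee_fin !mulr_ge0// invr_ge0 exprn_ge0.
rewrite le_eqVlt => /predU1P[<-|m0]; first exact: nneseries_ge0.
have exk : exists k, (2 ^- k < m)%R by exact: dyadic_lt.
case: (ex_minnP exk) => -[|k] km kmin; first by move: km; rewrite expr0 invr1 ltNge m1.
apply: (@le_trans _ _ (\sum_(0 <= j < k.+2) (2 * 2 ^- j * (P j)%:R)%:E)); last first.
  by apply: nneseries_lim_ge => j _ _; exact: s0.
rewrite big_nat_recr//= mP// mulr1; apply: lee_paddl.
  by apply: sume_ge0 => j _; exact: s0.
rewrite lee_fin exprS invfM mulrA divff ?mul1r// leNgt.
by apply/negP => /kmin; rewrite ltnn.
Qed.

Lemma measurable_inv_itv (t : R) : (0 < t)%R ->
  measurable_fun `]t, +oo[%classic (fun s : R => s^-1)%R.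
Proof.
move=> t0; apply: (measurability _ (RGenOInfty.measurableE R)) => _ [_ [c ->] <-].
apply: is_interval_measurable => r s /=; rewrite !in_itv/= !andbT.
move=> [tr _] [ts cs] u /andP[ru us]; have tu := lt_le_trans tr ru.
split; rewrite ?in_itv/= ?andbT//; apply: lt_le_trans cs _.
by rewrite lef_pV2 ?posrE ?(lt_trans t0).
Qed.

Local Notation lambda := (@lebesgue_measure R).

(* The sum of the weights [2 * 2 ^- k] over the [k] with [s < a * 2 ^+ k] is at
   most [4 * min 1 (a / s)]. *)
Lemma dyadic_calderon (F : R -> \bar R) (a t : R) :
  measurable_fun setT F -> (forall s, 0 <= F s) -> (0 < t <= a)%R ->
  \sum_(0 <= k <oo) (2 * 2 ^- k)%:E * \int[lambda]_(s in `]0%R, (a * 2 ^+ k)%R[) F s <=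
  (4 * a)%:E * ((t^-1)%:E * \int[lambda]_(s in `]0%R, t[) F s +
    \int[lambda]_(s in `]t, +oo[) (F s * (s^-1)%:E)).
Proof.
move=> mF F0 /andP[t0 ta]; have a0 : (0 < a)%R by exact: lt_le_trans ta.
have mFD D : measurable_fun D F by exact: (measurable_funS measurableT).
have w0 k : 0 <= (2 * 2 ^- k)%:E :> \bar R.
  by rewrite lee_fin mulr_ge0// invr_ge0 exprn_ge0.
pose I k := `]0%R, (a * 2 ^+ k)%R[%classic.
have mFI D : measurable D -> measurable_fun setT (F \_ D).
  by move=> mD; apply/(measurable_restrictT _ mD); exact: mFD.
have FI0 D s : 0 <= (F \_ D) s by rewrite /patch; case: ifP.
have -> : \sum_(0 <= k <oo) (2 * 2 ^- k)%:E * \int[lambda]_(s in I k) F s =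
    \int[lambda]_s \sum_(0 <= k <oo) (2 * 2 ^- k)%:E * (F \_ (I k)) s.
  rewrite integral_nneseries//; last 2 first.
  - by move=> k; apply: measurable_funeM; apply: mFI; exact: measurable_itv.
  - by move=> k s _; rewrite mule_ge0.
  apply: eq_eseriesr => k _; rewrite ge0_integralZl//; last first.
    by apply: mFI; exact: measurable_itv.
  by rewrite [in LHS]integral_mkcond.
pose G s := F s * (s^-1)%:E.
have mG : measurable_fun `]t, +oo[%classic G.
  apply: emeasurable_funM; first exact: mFD.
  by apply/measurable_EFinP; exact: measurable_inv_itv.
have G0 s : (t < s)%R -> 0 <= G s.
  by move=> ts; rewrite mule_ge0// lee_fin invr_ge0 ltW// (lt_trans t0).
have GI0 s : 0 <= (G \_ `]t, +oo[) s.
  by rewrite /patch; case: ifP => //; rewrite inE/= in_itv/= andbT; exact: G0.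
(* Closing the interval at [t] makes the two domains partition the positive half-line, for the
   pointwise comparison. *)
rewrite integral_itv_bndo_bndc//.
rewrite [X in _ * X + _]integral_mkcond [X in _ + X]integral_mkcond.
have mFt : measurable_fun setT (F \_ `]0%R, t]) by apply: mFI; exact: measurable_itv.
have mGt : measurable_fun setT (G \_ `]t, +oo[).
  have mt : measurable (`]t, +oo[%classic : set R) by exact: measurable_itv.
  exact/(measurable_restrictT _ mt).
have tV0 : 0 <= (t^-1)%:E by rewrite lee_fin invr_ge0 ltW.
rewrite -ge0_integralZl// -ge0_integralD//; first last.
- exact: measurable_funeM.
- by move=> s _; rewrite mule_ge0.
rewrite -ge0_integralZl//; first last.
- by rewrite lee_fin mulr_ge0// ltW.
- by move=> s _; rewrite adde_ge0// mule_ge0.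
- by apply: emeasurable_funD => //; exact: measurable_funeM.
apply: le_ge0_integral => s.
  by apply: nneseries_ge0 => k _ _; rewrite mule_ge0.
have [s0|s0] := leP s 0%R.
  rewrite eseries0; last first.
    move=> k _ _; rewrite /patch ifF ?mule0//.
    by apply/negbTE; rewrite notin_setE /I/= in_itv/= ltNge s0.
  by rewrite mule_ge0 ?adde_ge0 ?mule_ge0// lee_fin mulr_ge0// ltW.
have sumle N : \sum_(0 <= k < N) (2 * 2 ^- k)%:E * (F \_ (I k)) s <=
    (4 * Num.min 1 (a / s))%:E * F s.
  have as0 : (0 <= a / s)%R by rewrite divr_ge0// ltW.
  rewrite (eq_bigr (fun k => (2 * (2 ^- k * (2 ^- k < a / s)%R%:R))%:E * F s)); last first.
    move=> k _; rewrite /patch /I mem_setE in_itv/= s0/=.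
    rewrite ltr_pdivlMr// ltr_pdivrMl ?exprn_gt0// [(a * _)%R]mulrC.
    by case: ifP => _; rewrite ?mulr1 ?mulr0 ?mule0 ?mul0e.
  rewrite -ge0_sume_distrl; last first.
    by move=> k _; rewrite lee_fin !mulr_ge0// invr_ge0 exprn_ge0.
  apply: lee_wpmul2r => //; rewrite sumEFin lee_fin -mulr_sumr.
  by have := sum_dyadic_lt _ N as0; lra.
apply: (@le_trans _ _ ((4 * Num.min 1 (a / s))%:E * F s)).
  by apply: nneseries_le => // k; rewrite mule_ge0.
(* The minimum is bounded by [1 <= a / t] when [s <= t], and by [a / s] beyond. *)
have [st|ts] := leP s t.
  rewrite [X in _ + X]/patch ifF ?adde0; last first.
    by apply/negbTE; rewrite notin_setE/= in_itv/= andbT ltNge st.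
  rewrite /patch mem_set; last by rewrite /= in_itv/= s0.
  rewrite muleA -EFinM; apply: lee_wpmul2r => //; rewrite lee_fin.
  rewrite -mulrA ler_wpM2l// ge_min; apply/orP; left.
  by rewrite ler_pdivlMr ?mul1r.
rewrite [X in _ * X + _]/patch ifF ?mule0 ?add0e; last first.
  by apply/negbTE; rewrite notin_setE/= in_itv/= leNgt ts andbF.
rewrite /patch mem_set; last by rewrite /= in_itv/= ts.
rewrite /G [F s * _]muleC muleA -EFinM; apply: lee_wpmul2r => //; rewrite lee_fin.
by rewrite -mulrA ler_wpM2l// ge_min lexx orbT.
Qed.

End dyadic.

(** * The rearrangement estimate *)

Lemma EFin_between (R : realType) (x z : \bar R) : 0 <= x -> x < z ->
  exists2 y : R, x < y%:E & y%:E < z.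
Proof.
case: x => [r| |]//; case: z => [s| |]// _; rewrite ?lte_fin => rs.
  by exists ((r + s) / 2)%R; rewrite lte_fin; lra.
by exists (r + 1)%R; rewrite ?ltry// lte_fin; lra.
Qed.

(** * Admissible weights and integrals against their maximal functions *)

Section maximal_integral.
Context {R : realType} {n : nat}.
Local Notation mu := (@lebesgue R n).
Local Notation lambda := (@lebesgue_measure R).

Lemma bigcup_cube : \bigcup_k cube (0 : 'rV[R]_n.+1)%R k.+1%:R = setT.
Proof.
apply/seteqP; split => // x _.
pose r := (\big[Num.max/0]_i `|(x : 'rV[R]_n.+1) ord0 i|)%R.
exists (Num.truncn r) => // i; rewrite mxE subr0.
have r0 : (0 <= r)%R by exact: bigmax_ge_id.
have /andP[_] := truncn_itv r0; apply: le_lt_trans.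
by rewrite /r; apply: le_bigmax.
Qed.

(* The indicator of [A] is not an admissible weight, as weights are positive
   everywhere: [u] also has a small integrable tail off [A]. *)
Lemma positive_weight (A : set (Rn R n)) (m : R) :
  measurable A -> mu A = m%:E -> (0 < m)%R ->
  exists u : Rn R n -> R, [/\ measurable_fun setT u, forall x, (0 < u x <= 1)%R,
    forall x, A x -> u x = 1%R & \int[mu]_x (u x)%:E <= (2 * m)%:E].
Proof.
move=> mA Am m0.
pose Q k := cube (0 : 'rV[R]_n.+1)%R k.+1%:R.
have mQ k : measurable (Q k) by exact: measurable_cube.
have Qfin k : mu (Q k) \is a fin_num by rewrite ge0_fin_numE ?lebesgue_cube_lty.
pose q k := fine (mu (Q k)).
have q0 k : (0 <= q k)%R by exact: fine_ge0.
(* The first entry of the minimum gives [h <= 1], the second makes the integral of [h] at most [m];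
   the [+ 1] keeps the denominator positive. *)
pose c k := (Num.min 1 (m / (q k + 1)) / (2 ^ k.+1)%:R)%R.
have c0 k : (0 < c k)%R.
  by rewrite divr_gt0// lt_min ltr01 divr_gt0// ltr_wpDl.
have c1 k : (c k <= 1 / (2 ^ k.+1)%:R)%R.
  by rewrite ler_wpM2r// ge_min lexx.
have cm k : (c k * q k <= m / (2 ^ k.+1)%:R)%R.
  rewrite /c mulrAC ler_wpM2r//; apply: (@le_trans _ _ (m / (q k + 1) * q k)%R).
    by rewrite ler_wpM2r// ge_min lexx orbT.
  have qk1 : (0 < q k + 1)%R by rewrite ltr_wpDl.
  by rewrite mulrAC ler_pdivrMr// ler_wpM2l ?(ltW m0)// lerDl.
pose h x := \sum_(0 <= k <oo) (c k)%:E * (\1_(Q k) x)%:E.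
have h0k x k : 0 <= (c k)%:E * (\1_(Q k) x)%:E by rewrite mule_ge0// lee_fin// ltW.
have h0 x : 0 <= h x by exact: nneseries_ge0.
have h1 x : h x <= 1.
  apply: le_trans (epsilon_trick0 xpredT (@ler01 R)); apply: lee_nneseries => // k _.
  rewrite -EFinM lee_fin; apply: le_trans (c1 k).
  by rewrite ler_piMr ?(ltW (c0 k))// indicE lern1 leq_b1.
have hfin x : h x \is a fin_num.
  by rewrite ge0_fin_numE//; apply: le_lt_trans (h1 x) _; exact: ltry.
have hgt0 x : 0 < h x.
  have : (\bigcup_k Q k) x by rewrite bigcup_cube.
  move=> [k _ Qx]; apply: (@lt_le_trans _ _ (c k)%:E); first by rewrite lte_fin.
  apply: (@le_trans _ _ (\sum_(0 <= j < k.+1) (c j)%:E * (\1_(Q j) x)%:E)).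
    rewrite big_nat_recr//= indicE mem_set// mule1; apply: lee_paddl => //.
    exact: sume_ge0.
  by apply: nneseries_lim_ge => j _ _; exact: h0k.
have mhk k : measurable_fun setT (fun x => (c k)%:E * (\1_(Q k) x)%:E : \bar R).
  by apply: measurable_funeM; apply/measurable_EFinP/measurable_indic.
have mh : measurable_fun setT h.
  by apply: (@ge0_emeasurable_sum _ _ _ _ _ xpredT).
have hm : \int[mu]_x h x <= m%:E.
  rewrite integral_nneseries//.
  apply: le_trans (epsilon_trick0 xpredT (ltW m0)); apply: lee_nneseries => [k _ _|k _].
    by apply: integral_ge0.
  rewrite (ge0_integralZl_EFin _ measurableT); last 3 first.
  - by move=> x _; rewrite lee_fin indicE.
  - by apply/measurable_EFinP/measurable_indic.
  - exact: ltW.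
  rewrite integral_indic// setIT.
  have -> : (c k)%:E * mu (Q k) = (c k * q k)%:E by rewrite [RHS]EFinM /q fineK.
  by rewrite lee_fin.
(* A maximum, unlike a sum, stays at most 1 and equals 1 on [A]. *)
exists (\1_A \max (fine \o h))%R; split.
- apply: measurable_maxr; first exact: measurable_indic.
  by apply: (measurableT_comp _ mh); exact: fine_measurable.
- move=> x /=; rewrite lt_max ge_max indicE lern1 leq_b1 fine_gt0 ?orbT/=; last first.
    by rewrite hgt0/= (le_lt_trans (h1 x)) ?ltry.
  by rewrite -lee_fin fineK.
- move=> x Ax /=; rewrite indicE mem_set//; apply/max_idPl.
  by rewrite -lee_fin fineK.
- apply: (@le_trans _ _ (\int[mu]_x ((\1_A x)%:E + h x))).
    apply: le_ge0_integral => x; first by rewrite lee_fin le_max indicE ler0n.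
    rewrite -(fineK (hfin x)) -EFinD lee_fin /= ge_max lerDl lerDr.
    by rewrite indicE ler0n fine_ge0.
  rewrite (ge0_integralD _ measurableT); first last.
  - exact: mh.
  - by [].
  - by apply/measurable_EFinP/measurable_indic.
  - by move=> x _; rewrite lee_fin indicE.
  have Am' : mu A <= m%:E by rewrite Am.
  rewrite integral_indic// setIT mulr_natl mulr2n EFinD.
  by apply: leeD; [exact: Am'|exact: hm].
Qed.

Lemma maximal_ge0 (u : Rn R n -> R) x : 0 <= maximal u x.
Proof.
apply: le_trans (ereal_sup_ubound _); last first.
  exists (x : 'rV[R]_n.+1), 1%R; split => // i; by rewrite subrr normr0.
by rewrite mule_ge0 ?inve_ge0 ?measure_ge0//; exact: integral_ge0.
Qed.

Lemma maximal_le1 (u : Rn R n -> R) x : measurable_fun setT u ->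
  (forall y, (`|u y| <= 1)%R) -> maximal u x <= 1.
Proof.
move=> mu_ u1; apply: ge_ereal_sup => _ [z [r [r0 xz ->]]].
have uQ : \int[mu]_(y in cube z r) `|u y|%:E <= mu (cube z r).
  apply: (@le_trans _ _ (\int[mu]_(y in cube z r) cst 1 y)); last first.
    by rewrite integral_cst ?mul1e//; exact: measurable_cube.
  rewrite [leLHS]integral_mkcond [leRHS]integral_mkcond; apply: le_ge0_integral => y.
    by rewrite /patch; case: ifP.
  by rewrite /patch; case: ifP => // _; rewrite lee_fin.
have [m mE] : exists m : R, mu (cube z r) = m%:E.
  exists (fine (mu (cube z r))).
  by rewrite fineK// ge0_fin_numE// lebesgue_cube_lty.
have m0 : (0 <= m)%R by rewrite -lee_fin -mE.
have i0 : 0 <= \int[mu]_(y in cube z r) `|u y|%:E by exact: integral_ge0.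
(* On a null cube the integral is 0, so the average is 0 too. *)
rewrite le_eqVlt in m0; case/predU1P: m0 => m0; move: uQ; rewrite mE => i1.
  move: i1; rewrite -m0 => i1.
  by rewrite (le_anti (introT andP (conj i1 i0))) mule0.
by rewrite inver gt_eqF// lee_pdivrMl// mule1.
Qed.

(** The weak type bound at height [2 ^- k] gives [V k] of measure at most [a * 2 ^+ k] with
    [a = 5 ^+ n.+1 * m], matching the intervals of [dyadic_calderon]. Here [m] bounds the integral
    of the weight. *)
Lemma integral_mul_maximal_le (f : {mfun Rn R n >-> R}) (u : Rn R n -> R) (m t : R) :
  measurable_fun setT u -> (forall x, (`|u x| <= 1)%R) ->
  \int[mu]_x `|u x|%:E <= m%:E -> (0 < t <= 5 ^+ n.+1 * m)%R ->
  \int[mu]_x (`|f x|%:E * maximal u x) <=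
  (4 * (5 ^+ n.+1 * m))%:E *
    ((t^-1)%:E * \int[lambda]_(s in `]0%R, t[) rearrangement (EFin \o f) s +
     \int[lambda]_(s in `]t, +oo[) (rearrangement (EFin \o f) s * (s^-1)%:E)).
Proof.
move=> mu_ u1 um tm.
have k0 k : (0 < 2 ^- k :> R)%R by rewrite invr_gt0 exprn_gt0.
have /choice[V VP] k : exists V : set (Rn R n), [/\ measurable V,
    [set x | (2 ^- k)%:E < maximal u x] `<=` V & mu V <= (5 ^+ n.+1 * m * 2 ^+ k)%:E].
  have [V [mV Vu Vm]] := maximal_weak_type _ _ _ mu_ (k0 k) um; exists V; split => //.
  by rewrite -mulrA; rewrite invrK in Vm.
apply: le_trans (dyadic_calderon _ _ _ (measurable_rearrangement _ _) _ tm); last first.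
  by move=> s; exact: rearrangement_ge0.
have c0 k : 0 <= (2 * 2 ^- k)%:E :> \bar R by rewrite lee_fin mulr_ge0// ltW.
have mf : measurable_fun setT (fun x : Rn R n => `|f x|%:E).
  by apply/measurable_EFinP/measurableT_comp.
have mV k : measurable (V k) by have [] := VP k.
have mfV k : measurable_fun setT ((fun x : Rn R n => `|f x|%:E) \_ (V k)).
  by apply/(measurable_restrictT _ (mV k)); exact: measurable_funS mf.
have fV0 k x : 0 <= ((fun x : Rn R n => `|f x|%:E) \_ (V k)) x.
  by rewrite /patch; case: ifP.
apply: (@le_trans _ _ (\int[mu]_x \sum_(0 <= k <oo)
    ((2 * 2 ^- k)%:E * ((fun x : Rn R n => `|f x|%:E) \_ (V k)) x))).
  apply: le_ge0_integral => x; first by rewrite mule_ge0// maximal_ge0.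
  apply: (@le_trans _ _ (`|f x|%:E *
      \sum_(0 <= k <oo) (2 * 2 ^- k * (x \in V k)%:R)%:E)).
    apply: lee_wpmul2l => //; apply: le_dyadic_series.
      by rewrite maximal_ge0 maximal_le1.
    by move=> k ku; rewrite mem_set//; have [_ + _] := VP k; exact.
  rewrite -nneseriesZl; last by move=> k _; rewrite lee_fin mulr_ge0// -lee_fin.
  apply: lee_nneseries => k _.
    by move=> _; rewrite mule_ge0// lee_fin mulr_ge0// -lee_fin.
  rewrite /patch; case: ifP => _; last by rewrite mulr0 !mule0.
  by rewrite mulr1 muleC.
rewrite (integral_nneseries _ measurableT); last 2 first.
- by move=> k; exact: measurable_funeM.
- by move=> k x _; rewrite mule_ge0.
apply: lee_nneseries => [k _ _|k _].
  by apply: integral_ge0 => x _; rewrite mule_ge0.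
rewrite ge0_integralZl// -integral_mkcond; apply: lee_wpmul2l => //.
by apply: integral_le_rearrangement => //; have [] := VP k.
Qed.

End maximal_integral.

Theorem corollary4p1 (R : realType) (n : nat) (T : operator R n)
    (hT : sublinear T)
    (hFS : exists c : R, (0 < c)%R /\ fefferman_stein T c) :
  exists C : R, (0 < C)%R /\
    forall (t : R) (f : {mfun Rn R n >-> R}), (0 < t)%R ->
      rearrangement (T f) t <=
      C%:E * ((t^-1)%:E *
                \int[@lebesgue_measure R]_(s in `]0%R, t[)
                  rearrangement (EFin \o f) s +
              \int[@lebesgue_measure R]_(s in `]t, +oo[)
                (rearrangement (EFin \o f) s * (s^-1)%:E)).
Proof.
have [c [c0 FS]] := hFS.
(* The factors come from the Fefferman-Stein inequality, the dyadic summation, the Vitali covering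
   and the integral of the weight. *)
exists (c * (4 * (5 ^+ n.+1 * 2)))%R; split; first by rewrite !mulr_gt0// exprn_gt0.
move=> t f t0; set S := (X in _ <= _ * X).
have S0 : 0 <= S.
  rewrite /S adde_ge0 ?mule_ge0 ?lee_fin ?invr_ge0 ?(ltW t0)//.
    by apply: integral_ge0 => s _; exact: rearrangement_ge0.
  apply: integral_ge0 => s; rewrite /= in_itv/= andbT => ts.
  by rewrite mule_ge0 ?rearrangement_ge0// lee_fin invr_ge0 ltW// (lt_trans t0).
rewrite leNgt; apply/negP => SlT.
have CS0 : 0 <= (c * (4 * (5 ^+ n.+1 * 2)))%:E * S.
  by rewrite mule_ge0// lee_fin ltW// !mulr_gt0// exprn_gt0.
(* A real [y] strictly between the two sides makes [{|T f| > y}] of measure greater than [t]. *)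
have [y Sy yT] := EFin_between _ _ _ CS0 SlT.
have y0 : (0 < y)%R by rewrite -lte_fin; exact: le_lt_trans Sy.
have tE := lt_rearrangement _ _ _ y0 yT.
set E := [set x | y%:E < `|T f x|] in tE.
have mE : measurable E.
  rewrite -[E]setTI; apply: (emeasurable_fun_o_infty measurableT).
  exact: measurableT_comp.
pose Q k := cube (0 : 'rV[R]_n.+1)%R k.+1%:R.
have mEQ k : measurable (E `&` Q k).
  by apply: measurableI => //; exact: measurable_cube.
(* That set may have infinite measure; by continuity from below, its part in a large cube still has
   measure above [t], and it is finite. *)
have [k tk] : exists k, t%:E < lebesgue (E `&` Q k).
  apply: contrapT => /forallNP kt; move: tE; apply/negP; rewrite -leNgt.
  rewrite -[E]setIT -bigcup_cube setI_bigcupr.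
  have mcup : measurable (\bigcup_k (E `&` Q k)) by exact: bigcupT_measurable.
  have ndE : {homo (fun k => E `&` Q k) : i j / (i <= j)%N >-> (i <= j)%O}.
    move=> i j ij; apply/subsetPset => x [Ex Qx]; split => // l.
    by apply: lt_le_trans (Qx l) _; rewrite ler_nat.
  have cvE := @nondecreasing_cvg_mu _ _ _ (@lebesgue R n) _ mEQ mcup ndE.
  rewrite -(cvg_lim _ cvE)//; apply: lime_le; first by apply/cvg_ex; eexists; exact: cvE.
  by apply: nearW => k /=; rewrite leNgt; apply/negP/kt.
have EQfin : lebesgue (E `&` Q k) \is a fin_num.
  rewrite ge0_fin_numE//; apply: le_lt_trans (lebesgue_cube_lty (0 : 'rV[R]_n.+1)%R k.+1%:R).
  by apply: le_lebesgue_outer => x [].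
pose m := fine (lebesgue (E `&` Q k)).
have tm : (t < m)%R by rewrite -lte_fin fineK.
have m0 : (0 < m)%R by exact: lt_trans tm.
have [u [mu_ u01 uE um]] := positive_weight _ m (mEQ k) (esym (fineK EQfin)) m0.
have u0 x : (0 < u x)%R by have /andP[] := u01 x.
have uabs x : `|u x|%R = u x by rewrite gtr0_norm.
have u1 x : (`|u x| <= 1)%R by rewrite uabs; have /andP[] := u01 x.
have {}um : \int[@lebesgue R n]_x `|u x|%:E <= (2 * m)%:E.
  by under eq_integral do rewrite uabs.
have uloc : locally_integrable_rV u.
  split => // K _; apply: le_lt_trans (ltry (2 * m)%R); apply: le_trans um.
  rewrite integral_mkcond; apply: le_ge0_integral => x.
    by rewrite /patch; case: ifP.
  by rewrite /patch; case: ifP => // _; change (0 <= `|u x|%:E).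
have t2m : (0 < t <= 5 ^+ n.+1 * (2 * m))%R.
  rewrite t0/= (le_trans (ltW tm))// mulrA ler_peMl ?(ltW m0)//.
  by rewrite mulr_ege1 ?exprn_ege1 ?ler1n.
have yum : y%:E * m%:E <= y%:E * \int[@lebesgue R n]_(x in E) (u x)%:E.
  apply: lee_wpmul2l; first by rewrite lee_fin ltW.
  rewrite fineK// -[X in lebesgue X]setIT -integral_indic//.
  rewrite [leRHS]integral_mkcond; apply: le_ge0_integral => x.
    by rewrite lee_fin indicE.
  rewrite indicE /patch; case: (boolP (x \in E `&` Q k)) => [|_].
    by rewrite inE => xE; rewrite mem_set ?uE//; case: xE.
  by case: ifP => //; rewrite lee_fin ltW.
(* Fefferman-Stein bounds [y * m] by [m] times the claimed right-hand side, which is strictly below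
   [y]. *)
have := le_trans yum (FS u y f u0 uloc y0); apply/negP; rewrite -ltNge.
apply: (@le_lt_trans _ _ (c%:E * ((4 * (5 ^+ n.+1 * (2 * m)))%:E * S))).
  apply: lee_wpmul2l; first by rewrite lee_fin ltW.
  exact: integral_mul_maximal_le.
rewrite muleA -EFinM.
have -> : (c * (4 * (5 ^+ n.+1 * (2 * m))) = c * (4 * (5 ^+ n.+1 * 2)) * m)%R by ring.
by rewrite [X in X%:E * S]mulrC EFinM -muleA [X in _ < X]muleC lte_pmul2l// lte_fin.
Qed.
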